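(* Let $\mathbb F$ be a division ring. (1) Two controllable pairs $(A,\mathbf v)$ and $(A',\mathbf v')$ over $\mathbb F$ are similar if and only if their minimal polynomials are equal: $\mathfrak P_{A,\mathbf v}=\mathfrak P_{A',\mathbf v'}$. (2) Two observable pairs $(\mathbf u,A)$ and $(\mathbf u',A')$ over $\mathbb F$ are similar if and only if their minimal polynomials are equal: $\mathfrak P_{\mathbf u,A}=\mathfrak P_{\mathbf u',A'}$.
   Context: $\mathbb F[z]$ is the ring of polynomials over the division ring $\mathbb F$ in a formal variable $z$ commuting with the coefficients; every one-sided ideal of $\mathbb F[z]$ is principal. An input pair $(A,\mathbf v)$ consists of $A\in\mathbb F^{n\times n}$ and a column $\mathbf v\in\mathbb F^{n\times 1}$; an output pair $(\mathbf u,A)$ consists of $A\in\mathbb F^{n\times n}$ and a row $\mathbf u\in\mathbb F^{1\times n}$ ($n\ge1$). For $f(z)=\sum_j f_jz^j\in\mathbb F[z]$ put $(\mathbf v f)^{\mathfrak e_\ell}(A)=\sum_j A^j\mathbf v f_j$ and $(f\mathbf u)^{\mathfrak e_r}(A)=\sum_j f_j\mathbf uA^j$. The minimal polynomial $\mathfrak P_{A,\mathbf v}$ is the monic generator of the right ideal $\{p\in\mathbb F[z]:(\mathbf vp)^{\mathfrak e_\ell}(A)=0\}$; the minimal polynomial $\mathfrak P_{\mathbf u,A}$ is the monic generator of the left ideal $\{p\in\mathbb F[z]:(p\mathbf u)^{\mathfrak e_r}(A)=0\}$. $(A,\mathbf v)$ is controllable if $\mathfrak C_{A,\mathbf v}=[\mathbf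 v\ A\mathbf v\ \cdots\ A^{n-1}\mathbf v]$ is invertible; $(\mathbf u,A)$ is observable if the $n\times n$ matrix $\mathfrak O_{\mathbf u,A}$ with rows $\mathbf u,\mathbf uA,\dots,\mathbf uA^{n-1}$ is invertible. Input pairs $(A,\mathbf v)$, $(A',\mathbf v')$ are similar if $A'=TAT^{-1}$ and $\mathbf v'=T\mathbf v$ for some invertible $T\in\mathbb F^{n\times n}$; output pairs $(\mathbf u,A)$, $(\mathbf u',A')$ are similar if $A'=TAT^{-1}$ and $\mathbf u'=\mathbf uT^{-1}$ for some invertible $T\in\mathbb F^{n\times n}$ (in particular, similar pairs have matrices of the same size). *)

(* Defs.v *)
From mathcomp Require Import all_boot all_algebra.
From mathcomp Require Import boolp classical_sets.

Set Implicit Arguments.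
Unset Strict Implicit.
Unset Printing Implicit Defensive.
Import GRing.Theory.
Local Open Scope ring_scope.

(* There is no structure of division rings: they are the unit rings in which
   every nonzero element is a unit (a unitRingType is nontrivial, but need not
   be commutative). *)
Definition division_ring (F : unitRingType) : Prop :=
  forall x : F, x != 0 -> x \is a GRing.unit.

(* [unitmx] and [invmx] are based on determinants, hence are only available
   over commutative rings. *)
Definition mx_inverse (F : unitRingType) (n : nat) (T S : 'M[F]_n) : Prop :=
  T *m S = 1%:M /\ S *m T = 1%:M.

Definition mx_invertible (F : unitRingType) (n : nat) (T : 'M[F]_n) : Prop :=
  exists S, mx_inverse T S.

(* The product [c *m a%:M] scales the column [c] by [a] on the right, whereas
   [a *: r] scales the row [r] on the left. *)
Definition in_eval (F : unitRingType) (n : nat) (A : 'M[F]_n) (v : 'cV[F]_n)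
    (f : {poly F}) : 'cV[F]_n :=
  \sum_(j < size f) A ^+ j *m v *m (f`_j)%:M.

Definition out_eval (F : unitRingType) (n : nat) (u : 'rV[F]_n) (A : 'M[F]_n)
    (f : {poly F}) : 'rV[F]_n :=
  \sum_(j < size f) f`_j *: (u *m A ^+ j).

Definition is_in_minpoly (F : unitRingType) (n : nat) (A : 'M[F]_n)
    (v : 'cV[F]_n) (p : {poly F}) : Prop :=
  p \is monic /\ forall q, in_eval A v q = 0 <-> exists r, q = p * r.

Definition is_out_minpoly (F : unitRingType) (n : nat) (u : 'rV[F]_n)
    (A : 'M[F]_n) (p : {poly F}) : Prop :=
  p \is monic /\ forall q, out_eval u A q = 0 <-> exists r, q = r * p.

(* Over a division ring the polynomial so chosen exists and is unique: see
   [in_minpolyP], [is_in_minpoly_uniq] and their analogues below. *)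
Definition in_minpoly (F : unitRingType) (n : nat) (A : 'M[F]_n)
    (v : 'cV[F]_n) : {poly F} :=
  xget 0 [set p | is_in_minpoly A v p]%classic.

Definition out_minpoly (F : unitRingType) (n : nat) (u : 'rV[F]_n)
    (A : 'M[F]_n) : {poly F} :=
  xget 0 [set p | is_out_minpoly u A p]%classic.

Definition controllability_mx (F : unitRingType) (n : nat) (A : 'M[F]_n)
    (v : 'cV[F]_n) : 'M[F]_n :=
  \matrix_(i < n, j < n) (A ^+ j *m v) i ord0.

Definition observability_mx (F : unitRingType) (n : nat) (u : 'rV[F]_n)
    (A : 'M[F]_n) : 'M[F]_n :=
  \matrix_(i < n, j < n) (u *m A ^+ i) ord0 j.

Definition controllable (F : unitRingType) (n : nat) (A : 'M[F]_n)
    (v : 'cV[F]_n) : Prop :=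
  mx_invertible (controllability_mx A v).

Definition observable (F : unitRingType) (n : nat) (u : 'rV[F]_n)
    (A : 'M[F]_n) : Prop :=
  mx_invertible (observability_mx u A).

(* The two pairs may a priori have different sizes; the casts along [e] only
   identify the sizes. In both definitions [S] is the inverse of [T]. *)
Definition in_similar (F : unitRingType) (n n' : nat)
    (A : 'M[F]_n) (v : 'cV[F]_n) (A' : 'M[F]_n') (v' : 'cV[F]_n') : Prop :=
  exists (e : n = n') (T S : 'M[F]_n),
    [/\ mx_inverse T S,
        A' = castmx (e, e) (T *m A *m S) &
        v' = castmx (e, erefl) (T *m v)].

Definition out_similar (F : unitRingType) (n n' : nat)
    (u : 'rV[F]_n) (A : 'M[F]_n) (u' : 'rV[F]_n') (A' : 'M[F]_n') : Prop :=
  exists (e : n = n') (T S : 'M[F]_n),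
    [/\ mx_inverse T S,
        A' = castmx (e, e) (T *m A *m S) &
        u' = castmx (erefl, e) (u *m S)].

Lemma row_dependent (F : unitRingType) (divF : division_ring F) m
  (M : 'M[F]_(m.+1, m)) : exists2 c : 'rV[F]_m.+1, c != 0 & c *m M = 0.
Proof.
elim: m M => [|m IHm] M.
  exists (const_mx 1); last by apply/matrixP => i [].
  by apply/negP => /eqP/matrixP/(_ ord0 ord0)/eqP; rewrite !mxE oner_eq0.
have [i0 Mi0] : exists i0, forall i,
    M i ord0 * (M i0 ord0)^-1 * M i0 ord0 = M i ord0.
  have [i0 nz|z] := pickP (fun i => M i ord0 != 0).
    by exists i0 => i; rewrite mulrVK // divF.
  by exists ord0 => i; move: (z i) => /negbFE/eqP ->; rewrite !mul0r.
pose d i := M (lift i0 i) ord0 * (M i0 ord0)^-1.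
pose N : 'M[F]_(m.+1, m) := \matrix_(i, j)
  (M (lift i0 i) (lift ord0 j) - d i * M i0 (lift ord0 j)).
have [c nzc cN] := IHm N.
pose c' : 'rV[F]_m.+2 := \row_j
  (if unlift i0 j is Some i then c ord0 i else - \sum_i c ord0 i * d i).
exists c'.
  apply: contra nzc => /eqP c0; apply/eqP/rowP => i.
  by move/rowP: c0 => /(_ (lift i0 i)); rewrite !mxE liftK.
apply/rowP => j; rewrite !mxE (bigD1_ord i0) //= !mxE unlift_none.
under eq_bigr => i _ do rewrite mxE liftK.
rewrite mulNr mulr_suml addrC -sumrB.
have [k ->|->] := unliftP ord0 j.
  move/rowP: cN => /(_ k); rewrite !mxE => cN; rewrite -[RHS]cN.
  by apply: eq_bigr => i _; rewrite [in RHS]mxE mulrBr -[in LHS]mulrA.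
by rewrite big1 // => i _; rewrite -mulrA /d Mi0 subrr.
Qed.

Lemma col_dependent (F : unitRingType) (divF : division_ring F) m
  (M : 'M[F]_(m, m.+1)) : exists2 c : 'cV[F]_m.+1, c != 0 & M *m c = 0.
Proof.
have [c c0 cM] := @row_dependent F^c divF m (M^T : 'M[F^c]_(m.+1, m)).
exists (c^T : 'cV[F]_m.+1).
  apply: contra c0 => /eqP/colP c0; apply/eqP/rowP => j.
  by move: (c0 j); rewrite !mxE.
apply/colP => i; move/rowP: cM => /(_ i); rewrite !mxE => cM.
rewrite -[RHS]cM; apply: eq_bigr => j _; rewrite !mxE //.
Qed.

Section WellDefined.
Variables (F : unitRingType) (divF : division_ring F).

Let size_eq1 (q p r s : {poly F}) :
  (0 < size r)%N -> (0 < size s)%N ->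
  size p = (size q + size r).-1 -> size q = (size p + size s).-1 -> size r = 1%N.
Proof.
case: (size r) (size s) => // r' [] // s' _ _; rewrite !addnS /= => -> /eqP.
by rewrite -addnA -{1}[size q]addn0 eqn_add2l eq_sym addn_eq0 => /andP[/eqP ->].
Qed.

Lemma monic_div_step (p q s : {poly F}) :
  q != 0 -> size s = size q -> lead_coef s = lead_coef q ->
  (size (q - s)%R < size q)%N.
Proof.
move=> q0 ss ls; have sq : (0 < size q)%N by rewrite lt0n size_poly_eq0.
rewrite -(ltn_predK sq) ltnS; apply/leq_sizeP => j.
rewrite leq_eqVlt coefB => /orP[/eqP <-|lj].
  by rewrite -{2}ss -!lead_coefE ls subrr.
by rewrite !nth_default ?subrr ?ss // -(prednK sq).
Qed.

Lemma right_ideal_gen (I : {poly F} -> Prop) :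
  (forall f g, I f -> I g -> I (f - g)) ->
  (forall f g, I f -> I (f * g)) ->
  (exists2 f, f != 0 & I f) ->
  exists p, p \is monic /\ forall q, I q <-> exists r, q = p * r.
Proof.
move=> IB IM [f0 nzf0 If0].
have [p [mp Ip minp]] : exists p, [/\ p \is monic, I p &
    forall q, I q -> (size q < size p)%N -> q = 0].
  have [n] := ubnP (size f0); elim: n => // n IHn in f0 nzf0 If0 *.
  rewrite ltnS => sf.
  case: (pselect (exists q, [/\ q != 0, I q & (size q < size f0)%N])).
    by case=> q [q0 Iq sq]; apply: (IHn q) => //; apply: leq_trans sq sf.
  move=> H; exists (f0 * (lead_coef f0)^-1%:P).
  have ul : lead_coef f0 \is a GRing.unit by rewrite divF ?lead_coef_eq0.
  have nl : lead_coef f0 * lead_coef ((lead_coef f0)^-1%:P) != 0.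
    by rewrite lead_coefC divrr ?oner_eq0.
  split; first by rewrite monicE lead_coef_proper_mul // lead_coefC divrr.
    exact: IM.
  rewrite size_proper_mul // size_polyC invr_eq0 lead_coef_eq0 nzf0 addn1 /=.
  move=> q Iq sq; apply/eqP; apply: contrapT => /negP q0.
  by apply: H; exists q.
exists p; split=> // q; split=> [|[r ->]]; last exact: IM.
have [n] := ubnP (size q); elim: n => // n IHn in q *; rewrite ltnS => sqn Iq.
have [sqp|spq] := ltnP (size q) (size p).
  by exists 0; rewrite mulr0 (minp q).
have [->|q0] := eqVneq q 0; first by exists 0; rewrite mulr0.
pose t := (lead_coef q)%:P * 'X^(size q - size p).
have lq : lead_coef q != 0 by rewrite lead_coef_eq0.
have t0 : t != 0 by rewrite -lead_coef_eq0 lead_coef_Mmonic ?monicXn ?lead_coefC.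
have p0 : (0 < size p)%N by rewrite size_poly_gt0 monic_neq0.
have sq : (size (q - p * t)%R < size q)%N.
  apply: (@monic_div_step p) => //.
    rewrite size_monicM // size_Mmonic ?polyC_eq0 ?monicXn //.
    by rewrite size_polyC lq size_polyXn add1n /= addnS /= subnKC.
  by rewrite lead_coef_monicM // lead_coef_Mmonic ?monicXn ?lead_coefC.
have [r /eqP] := IHn _ (leq_trans sq sqn) (IB _ _ Iq (IM _ t Ip)).
by rewrite subr_eq -mulrDr => /eqP ->; exists (r + t).
Qed.

Lemma left_ideal_gen (I : {poly F} -> Prop) :
  (forall f g, I f -> I g -> I (f - g)) ->
  (forall f g, I f -> I (g * f)) ->
  (exists2 f, f != 0 & I f) ->
  exists p, p \is monic /\ forall q, I q <-> exists r, q = r * p.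
Proof.
move=> IB IM [f0 nzf0 If0].
have [p [mp Ip minp]] : exists p, [/\ p \is monic, I p &
    forall q, I q -> (size q < size p)%N -> q = 0].
  have [n] := ubnP (size f0); elim: n => // n IHn in f0 nzf0 If0 *.
  rewrite ltnS => sf.
  case: (pselect (exists q, [/\ q != 0, I q & (size q < size f0)%N])).
    by case=> q [q0 Iq sq]; apply: (IHn q) => //; apply: leq_trans sq sf.
  move=> H; exists ((lead_coef f0)^-1%:P * f0).
  have ul : lead_coef f0 \is a GRing.unit by rewrite divF ?lead_coef_eq0.
  have nl : lead_coef ((lead_coef f0)^-1%:P) * lead_coef f0 != 0.
    by rewrite lead_coefC mulVr ?oner_eq0.
  split; first by rewrite monicE lead_coef_proper_mul // lead_coefC mulVr.
    exact: IM.
  rewrite size_proper_mul // size_polyC invr_eq0 lead_coef_eq0 nzf0 add1n /=.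
  move=> q Iq sq; apply/eqP; apply: contrapT => /negP q0.
  by apply: H; exists q.
exists p; split=> // q; split=> [|[r ->]]; last exact: IM.
have [n] := ubnP (size q); elim: n => // n IHn in q *; rewrite ltnS => sqn Iq.
have [sqp|spq] := ltnP (size q) (size p).
  by exists 0; rewrite mul0r (minp q).
have [->|q0] := eqVneq q 0; first by exists 0; rewrite mul0r.
pose t := (lead_coef q)%:P * 'X^(size q - size p).
have lq : lead_coef q != 0 by rewrite lead_coef_eq0.
have t0 : t != 0 by rewrite -lead_coef_eq0 lead_coef_Mmonic ?monicXn ?lead_coefC.
have p0 : (0 < size p)%N by rewrite size_poly_gt0 monic_neq0.
have sq : (size (q - t * p)%R < size q)%N.
  apply: (@monic_div_step p) => //.
    rewrite size_Mmonic // size_Mmonic ?polyC_eq0 ?monicXn //.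
    by rewrite size_polyC lq size_polyXn add1n /= subnK.
  by rewrite lead_coef_Mmonic // lead_coef_Mmonic ?monicXn ?lead_coefC.
have [r /eqP] := IHn _ (leq_trans sq sqn) (IB _ _ Iq (IM _ t Ip)).
by rewrite subr_eq -mulrDl => /eqP ->; exists (r + t).
Qed.

Section Input.
Variables (n : nat) (A : 'M[F]_n).
Implicit Types (v : 'cV[F]_n) (f g : {poly F}).

Lemma in_eval_wide v f m : (size f <= m)%N ->
  in_eval A v f = \sum_(j < m) A ^+ j *m v *m (f`_j)%:M.
Proof.
move=> sf; rewrite /in_eval (big_ord_widen _ (fun j => A ^+ j *m v *m (f`_j)%:M) sf).
rewrite big_mkcond; apply: eq_bigr => j _; case: ltnP => // /(nth_default 0) ->.
by rewrite raddf0 mulmx0.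
Qed.

Lemma in_evalB v f g : in_eval A v (f - g) = in_eval A v f - in_eval A v g.
Proof.
pose m := maxn (size f) (size g).
rewrite !(@in_eval_wide _ _ m) ?leq_maxl ?leq_maxr //; last first.
  by rewrite (leq_trans (size_polyD _ _)) // size_polyN.
by rewrite -sumrB; apply: eq_bigr => j _; rewrite coefB raddfB mulmxBr.
Qed.

Lemma in_eval0 v : in_eval A v 0 = 0.
Proof. by rewrite /in_eval size_poly0 big_ord0. Qed.

Lemma in_evalD v f g : in_eval A v (f + g) = in_eval A v f + in_eval A v g.
Proof.
by rewrite -{1}[g]opprK in_evalB -[- g]sub0r in_evalB in_eval0 sub0r opprK.
Qed.

Lemma in_evalMX v f : in_eval A v (f * 'X) = A *m in_eval A v f.
Proof.
rewrite (@in_eval_wide _ _ (size f).+1).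
  rewrite big_ord_recl coefMX /= raddf0 mulmx0 add0r mulmx_sumr.
  apply: eq_bigr => j _; rewrite coefMX /= exprS.
  by rewrite -[A * _]/(A *m _) !mulmxA.
have [->|f0] := eqVneq f 0; first by rewrite mul0r size_poly0.
by rewrite size_mulX.
Qed.

Lemma in_evalMC v f c : in_eval A v (f * c%:P) = in_eval A v f *m c%:M.
Proof.
rewrite (@in_eval_wide _ _ (size f)).
  rewrite mulmx_suml; apply: eq_bigr => j _.
  by rewrite coefMC scalar_mxM mulmxA.
by apply/leq_sizeP => j /(nth_default 0) fj; rewrite coefMC fj mul0r.
Qed.

Lemma in_evalM v f g : in_eval A v (f * g) = in_eval A (in_eval A v f) g.
Proof.
elim/poly_ind: g => [|g c IHg]; first by rewrite mulr0 !in_eval0.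
rewrite mulrDr mulrA !in_evalD !in_evalMX IHg in_evalMC; congr (_ + _).
rewrite (@in_eval_wide _ c%:P 1) ?size_polyC_leq1 // big_ord1 coefC /=.
by rewrite expr0 mul1mx.
Qed.

Lemma in_annihilated v : exists2 f, f != 0 & in_eval A v f = 0.
Proof.
pose M : 'M[F]_(n, n.+1) := \matrix_(i, j) (A ^+ j *m v) i ord0.
have [c c0 Mc] := col_dependent divF M.
exists (\poly_(j < n.+1) c (inord j) ord0).
  apply: contra c0 => /eqP/polyP f0; apply/eqP/colP => j.
  by move: (f0 j); rewrite coef_poly ltn_ord inord_val coef0 mxE.
rewrite (in_eval_wide _ (size_poly _ _)).
rewrite -[RHS]Mc; apply/colP => i; rewrite summxE [in RHS]mxE; apply: eq_bigr => j _.
by rewrite coef_poly ltn_ord inord_val !mxE big_ord1 !mxE eqxx mulr1n.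
Qed.

Lemma is_in_minpoly_uniq v p q :
  is_in_minpoly A v p -> is_in_minpoly A v q -> p = q.
Proof.
move=> [mp Ip] [mq Iq].
have [r pr] : exists r, p = q * r by apply/Iq/Ip; exists 1; rewrite mulr1.
have [s qs] : exists s, q = p * s by apply/Ip/Iq; exists 1; rewrite mulr1.
have rm : r \is monic by rewrite -(monicMl _ mq) -pr.
have sm : s \is monic by rewrite -(monicMl _ mp) -qs.
have r1 : size r = 1%N.
  apply: (@size_eq1 q p r s); rewrite ?size_poly_gt0 ?monic_neq0 //.
    by rewrite {1}pr size_monicM ?monic_neq0.
  by rewrite {1}qs size_monicM ?monic_neq0.
have r1C : (size r <= 1)%N by rewrite r1.
move: rm; rewrite pr (size1_polyC r1C) monicE lead_coefC => /eqP ->.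
by rewrite mulr1.
Qed.

Lemma in_minpolyP v : is_in_minpoly A v (in_minpoly A v).
Proof.
apply: (@xgetPex _ 0 [set p | is_in_minpoly A v p]%classic).
apply: right_ideal_gen (in_annihilated v) => f g.
  by rewrite in_evalB => -> ->; rewrite subrr.
rewrite in_evalM => ->; rewrite /in_eval big1 // => j _.
by rewrite mulmx0 mul0mx.
Qed.

End Input.

Section Output.
Variables (n : nat) (A : 'M[F]_n).
Implicit Types (u : 'rV[F]_n) (f g : {poly F}).

Lemma out_eval_wide u f m : (size f <= m)%N ->
  out_eval u A f = \sum_(j < m) f`_j *: (u *m A ^+ j).
Proof.
move=> sf; rewrite /out_eval (big_ord_widen _ (fun j => f`_j *: (u *m A ^+ j)) sf).
rewrite big_mkcond; apply: eq_bigr => j _; case: ltnP => // /(nth_default 0) ->.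
by rewrite scale0r.
Qed.

Lemma out_evalB u f g : out_eval u A (f - g) = out_eval u A f - out_eval u A g.
Proof.
pose m := maxn (size f) (size g).
rewrite !(@out_eval_wide _ _ m) ?leq_maxl ?leq_maxr //; last first.
  by rewrite (leq_trans (size_polyD _ _)) // size_polyN.
by rewrite -sumrB; apply: eq_bigr => j _; rewrite coefB scalerBl.
Qed.

Lemma out_eval0 u : out_eval u A 0 = 0.
Proof. by rewrite /out_eval size_poly0 big_ord0. Qed.

Lemma out_evalD u f g : out_eval u A (f + g) = out_eval u A f + out_eval u A g.
Proof.
by rewrite -{1}[g]opprK out_evalB -[- g]sub0r out_evalB out_eval0 sub0r opprK.
Qed.

Lemma out_evalMX u f : out_eval u A (f * 'X) = out_eval u A f *m A.
Proof.
rewrite (@out_eval_wide _ _ (size f).+1).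
  rewrite big_ord_recl coefMX /= scale0r add0r mulmx_suml.
  apply: eq_bigr => j _; rewrite coefMX /= exprSr.
  by rewrite -[_ * A]/(_ *m A) mulmxA scalemxAl.
have [->|f0] := eqVneq f 0; first by rewrite mul0r size_poly0.
by rewrite size_mulX.
Qed.

Lemma out_evalCM u f c : out_eval u A (c%:P * f) = c *: out_eval u A f.
Proof.
rewrite (@out_eval_wide _ _ (size f)).
  rewrite scaler_sumr; apply: eq_bigr => j _.
  by rewrite coefCM scalerA.
by apply/leq_sizeP => j /(nth_default 0) fj; rewrite coefCM fj mulr0.
Qed.

Lemma out_evalM u f g : out_eval u A (g * f) = out_eval (out_eval u A f) A g.
Proof.
elim/poly_ind: g => [|g c IHg]; first by rewrite mul0r !out_eval0.
rewrite mulrDl -mulrA -commr_polyX mulrA !out_evalD !out_evalMX IHg out_evalCM.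
congr (_ + _); rewrite (@out_eval_wide _ c%:P 1) ?size_polyC_leq1 // big_ord1.
by rewrite coefC /= expr0 mulmx1.
Qed.

Lemma out_annihilated u : exists2 f, f != 0 & out_eval u A f = 0.
Proof.
pose M : 'M[F]_(n.+1, n) := \matrix_(i, j) (u *m A ^+ i) ord0 j.
have [c c0 Mc] := row_dependent divF M.
exists (\poly_(j < n.+1) c ord0 (inord j)).
  apply: contra c0 => /eqP/polyP f0; apply/eqP/rowP => j.
  by move: (f0 j); rewrite coef_poly ltn_ord inord_val coef0 mxE.
rewrite (out_eval_wide _ (size_poly _ _)).
rewrite -[RHS]Mc; apply/rowP => i; rewrite summxE [in RHS]mxE.
by apply: eq_bigr => j _; rewrite coef_poly ltn_ord inord_val !mxE.
Qed.

Lemma is_out_minpoly_uniq u p q :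
  is_out_minpoly u A p -> is_out_minpoly u A q -> p = q.
Proof.
move=> [mp Ip] [mq Iq].
have [r pr] : exists r, p = r * q by apply/Iq/Ip; exists 1; rewrite mul1r.
have [s qs] : exists s, q = s * p by apply/Ip/Iq; exists 1; rewrite mul1r.
have rm : r \is monic by rewrite -(monicMr _ mq) -pr.
have sm : s \is monic by rewrite -(monicMr _ mp) -qs.
have r1 : size r = 1%N.
  apply: (@size_eq1 q p r s); rewrite ?size_poly_gt0 ?monic_neq0 //.
    by rewrite {1}pr size_Mmonic ?monic_neq0 // addnC.
  by rewrite {1}qs size_Mmonic ?monic_neq0 // addnC.
have r1C : (size r <= 1)%N by rewrite r1.
move: rm; rewrite pr (size1_polyC r1C) monicE lead_coefC => /eqP ->.
by rewrite mul1r.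
Qed.

Lemma out_minpolyP u : is_out_minpoly u A (out_minpoly u A).
Proof.
apply: (@xgetPex _ 0 [set p | is_out_minpoly u A p]%classic).
apply: left_ideal_gen (out_annihilated u) => f g.
  by rewrite out_evalB => -> ->; rewrite subrr.
rewrite out_evalM => ->; rewrite /out_eval big1 // => j _.
by rewrite mul0mx scaler0.
Qed.

End Output.

End WellDefined.

(* Main.v *)
Require Import Defs.
From mathcomp Require Import all_boot all_algebra.

(* Similarity by T turns the value of f at (A, v) into T times that value, so
   similar pairs have the same annihilating polynomials. Conversely, by
   controllability the values of the polynomials of degree < n at (A, v) are
   pairwise distinct and fill the space, so the minimal polynomial p has degree
   n; in particular it determines n. The matrix T = C' C^-1, with C and C' the
   controllability matrices, then maps f(A, v) to f(A', v') whenever deg f < n,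
   hence also for f = z^n, as z^n and z^n - p have the same value at both pairs.
   Thus T A and A' T agree on the basis v, A v, ..., A^(n-1) v. Output pairs are
   treated symmetrically. *)

Set Implicit Arguments.
Unset Strict Implicit.
Unset Printing Implicit Defensive.
Import GRing.Theory.
Local Open Scope ring_scope.

(** * Composition of inverse pairs, and sizes of polynomials z^n - f *)

Lemma mx_inverseM (F : unitRingType) n (T S T' S' : 'M[F]_n) :
  mx_inverse T S -> mx_inverse T' S' -> mx_inverse (T *m T') (S' *m S).
Proof.
move=> [TS ST] [TS' ST']; split.
  by rewrite mulmxA -(mulmxA T) TS' mulmx1.
by rewrite mulmxA -(mulmxA S') ST mulmx1.
Qed.

Lemma mx_inverseC (F : unitRingType) n (T S : 'M[F]_n) :
  mx_inverse T S -> mx_inverse S T.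
Proof. by case. Qed.

Lemma size_XnB (R : nzRingType) n (f : {poly R}) :
  (size f <= n)%N -> size ('X^n - f) = n.+1.
Proof.
by move=> sf; rewrite size_polyDl size_polyXn // size_polyN ltnS.
Qed.

(** The leading terms cancel. When p annihilates a pair, z^n - p thus stands in for z^n and has
    degree below n. *)
Lemma size_XnB_monic (R : unitRingType) n (p : {poly R}) :
  p \is monic -> size p = n.+1 -> (size ('X^n - p)%R <= n)%N.
Proof.
move=> mp sp; rewrite -ltnS -[n.+1](size_polyXn R).
apply: monic_div_step; rewrite ?monic_neq0 ?monicXn ?size_polyXn //.
by rewrite lead_coefXn (monicP mp).
Qed.

(** * Controllable input pairs *)

Section Input.
Variable F : unitRingType.

Lemma in_evalXn n (A : 'M[F]_n) v k : in_eval A v 'X^k = A ^+ k *m v.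
Proof.
rewrite /in_eval size_polyXn big_ord_recr /= big1 ?add0r => [|j _].
  by rewrite coefXn eqxx mulmx1.
by rewrite coefXn ltn_eqF ?raddf0 ?mulmx0.
Qed.

(** Since S T = 1, the inner factors telescope: (T A S)^j T = T A^j. *)
Lemma in_eval_similar n (A : 'M[F]_n) v T S f : mx_inverse T S ->
  in_eval (T *m A *m S) (T *m v) f = T *m in_eval A v f.
Proof.
case=> _ ST; rewrite /in_eval mulmx_sumr; apply: eq_bigr => j _.
rewrite !mulmxA; congr (_ *m _ *m _).
elim: (j : nat) => [|k IHk]; first by rewrite !expr0 mul1mx mulmx1.
rewrite !exprS -![_ * _]/(_ *m _) -mulmxA IHk !mulmxA.
by rewrite -(mulmxA _ S T) ST mulmx1.
Qed.

(** This turns questions about polynomials of degree below n into linear algebra: the coefficients,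
    acting from the right, combine the columns A^j v. *)
Lemma in_eval_controllability n (A : 'M[F]_n) v (f : {poly F}) : (size f <= n)%N ->
  in_eval A v f = controllability_mx A v *m \col_i f`_i.
Proof.
move=> sf; rewrite (in_eval_wide _ _ sf); apply/colP => i.
rewrite summxE !mxE; apply: eq_bigr => j _.
by rewrite !mxE big_ord1 !mxE eqxx mulr1n.
Qed.

Section Controllable.
Variables (n : nat) (A : 'M[F]_n) (v : 'cV[F]_n).
Hypothesis ctrlAv : controllable A v.

Lemma in_eval_eq0 (f : {poly F}) : (size f <= n)%N -> in_eval A v f = 0 -> f = 0.
Proof.
case: ctrlAv => C' [_ C'C] sf; rewrite in_eval_controllability // => f0.
have {f0} : \col_(i < n) f`_i = 0.
  by rewrite -[LHS]mul1mx -C'C -mulmxA f0 mulmx0.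
move/colP => f0; apply/polyP => i; rewrite coef0.
have [ni|lt_in] := leqP n i; first by rewrite nth_default // (leq_trans sf).
by have := f0 (Ordinal lt_in); rewrite !mxE.
Qed.

Lemma in_eval_surj w : exists2 f : {poly F}, (size f <= n)%N & in_eval A v f = w.
Proof.
case: ctrlAv => C' [CC' _].
(* The coefficients are the entries of C^-1 w; [insub] only converts an index to an ordinal, and its
   default 0 is never reached below n. *)
pose f := \poly_(i < n) oapp (fun j => (C' *m w) j ord0) 0 (insub i).
exists f; first exact: size_poly.
rewrite in_eval_controllability ?size_poly //.
suff -> : \col_(i < n) f`_i = C' *m w by rewrite mulmxA CC' mul1mx.
by apply/colP => i; rewrite mxE coef_poly ltn_ord valK.
Qed.

(** A nonzero annihilating polynomial cannot have degree below n. Conversely A^n v is the value of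
    some g of degree below n, so p divides z^n - g on the left and has degree at most n. *)
Lemma size_in_minpoly (divF : division_ring F) :
  size (in_minpoly A v) = n.+1.
Proof.
have [mp Ip] := in_minpolyP divF A v; set p := in_minpoly A v in mp Ip *.
apply/eqP; rewrite eqn_leq; apply/andP; split; last first.
  rewrite ltnNge; apply/negP => sp; have /eqP := monic_neq0 mp; apply.
  by apply: in_eval_eq0 => //; apply/Ip; exists 1; rewrite mulr1.
have [g sg gE] := in_eval_surj (A ^+ n *m v).
have [r def_r] : exists r, 'X^n - g = p * r.
  by apply/Ip; rewrite in_evalB in_evalXn gE subrr.
have r0 : r != 0.
  by apply: contra_eq_neq (size_XnB sg) => r0; rewrite def_r r0 mulr0 size_poly0.
rewrite -(size_XnB sg) def_r size_monicM //.
by rewrite -(prednK (n := size r)) ?size_poly_gt0 // addnS leq_addr.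
Qed.

End Controllable.

(** By uniqueness it suffices that the first minimal polynomial generates the annihilator of the
    second pair; multiplying by S removes the factor T. *)
Lemma in_similar_minpoly (divF : division_ring F) n n'
    (A : 'M[F]_n) v (A' : 'M[F]_n') v' :
  in_similar A v A' v' -> in_minpoly A v = in_minpoly A' v'.
Proof.
case=> e; subst n' => -[T [S [TS]]]; rewrite !castmx_id => -> ->.
have [_ ST] := TS; have [mp Ip] := in_minpolyP divF A v.
apply: is_in_minpoly_uniq (in_minpolyP divF _ _).
split=> // q; rewrite -Ip in_eval_similar //; split=> [Tq|->]; last exact: mulmx0.
by rewrite -[LHS]mul1mx -ST -mulmxA Tq mulmx0.
Qed.

Lemma in_minpoly_similar (divF : division_ring F) n n'
    (A : 'M[F]_n) v (A' : 'M[F]_n') v' :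
  controllable A v -> controllable A' v' ->
  in_minpoly A v = in_minpoly A' v' -> in_similar A v A' v'.
Proof.
move=> cA cA' eqp.
(* Both sizes are read off from the degree of the common minimal polynomial. *)
have [e] : n.+1 = n'.+1 by rewrite -(size_in_minpoly cA) // eqp size_in_minpoly.
subst n'; have [mp Ip] := in_minpolyP divF A v.
have [_ Ip'] := in_minpolyP divF A' v'.
have sp := size_in_minpoly cA divF; rewrite -eqp in Ip'.
set p := in_minpoly A v in mp Ip Ip' sp.
have p0 : in_eval A v p = 0 by apply/Ip; exists 1; rewrite mulr1.
have p0' : in_eval A' v' p = 0 by apply/Ip'; exists 1; rewrite mulr1.
case: (cA) (cA') => [C1 CC1] [C1' CC1'].
set C := controllability_mx A v in CC1; set C' := controllability_mx A' v' in CC1'.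
have TS := mx_inverseM CC1' (mx_inverseC CC1).
exists erefl, (C' *m C1), (C *m C1'); rewrite !castmx_id.
set T := C' *m C1 in TS *; set S := C *m C1' in TS *.
have TC : T *m C = C' by rewrite -mulmxA CC1.2 mulmx1.
have T_eval (f : {poly F}) : (size f <= n)%N -> T *m in_eval A v f = in_eval A' v' f.
  by move=> sf; rewrite !in_eval_controllability // mulmxA TC.
have T_pow k : (k <= n)%N -> T *m (A ^+ k *m v) = A' ^+ k *m v'.
  rewrite leq_eqVlt => /predU1P[->|lt_kn]; last first.
    by rewrite -!in_evalXn T_eval // size_polyXn.
  (* For k = n, apply [T_eval] to z^n - p; the terms in p vanish at both pairs. *)
  have := T_eval _ (size_XnB_monic mp sp).
  by rewrite !in_evalB p0 p0' !subr0 !in_evalXn.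
(* Column j is T A^(j+1) v on the left and A'^(j+1) v' on the right; the last column, j = n - 1, is
   where [T_pow] is needed at k = n. *)
have TAC : T *m A *m C = A' *m C'.
  have colC B (w : 'cV[F]_n) (j : 'I_n) :
      col j (controllability_mx B w) = B ^+ j *m w.
    by apply/colP => i; rewrite !mxE.
  apply/matrixP => i j; suff /colP/(_ i) : col j (T *m A *m C) = col j (A' *m C').
    by rewrite !mxE.
  clearbody T; rewrite 2!colE -!mulmxA -!colE !colC !(mulmxA _ (_ ^+ _)).
  rewrite -![_ *m _ ^+ _]/(_ * _) -!exprS.
  by rewrite T_pow.
split=> //; last by have := T_pow 0 isT; rewrite !expr0 !mul1mx.
by rewrite mulmxA TAC -mulmxA CC1'.1 mulmx1.
Qed.

End Input.

(** * Observable output pairs *)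

Section Output.
Variable F : unitRingType.

Lemma out_evalXn n u (A : 'M[F]_n) k : out_eval u A 'X^k = u *m A ^+ k.
Proof.
rewrite /out_eval size_polyXn big_ord_recr /= big1 ?add0r => [|j _].
  by rewrite coefXn eqxx scale1r.
by rewrite coefXn ltn_eqF ?scale0r.
Qed.

Lemma out_eval_similar n u (A : 'M[F]_n) T S f : mx_inverse T S ->
  out_eval (u *m S) (T *m A *m S) f = out_eval u A f *m S.
Proof.
case=> _ ST; rewrite /out_eval mulmx_suml; apply: eq_bigr => j _.
rewrite -scalemxAl; congr (_ *: _).
elim: (j : nat) => [|k IHk]; first by rewrite !expr0 !mulmx1.
rewrite !exprSr -![_ * _]/(_ *m _) mulmxA IHk !mulmxA.
by rewrite -(mulmxA _ S T) ST mulmx1.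
Qed.

Lemma out_eval_observability n u (A : 'M[F]_n) (f : {poly F}) : (size f <= n)%N ->
  out_eval u A f = \row_i f`_i *m observability_mx u A.
Proof.
move=> sf; rewrite (out_eval_wide _ _ sf); apply/rowP => i.
by rewrite summxE !mxE; apply: eq_bigr => j _; rewrite !mxE.
Qed.

Section Observable.
Variables (n : nat) (u : 'rV[F]_n) (A : 'M[F]_n).
Hypothesis obsuA : observable u A.

(** Coefficient rows act from the left, so injectivity now uses the right inverse of the
    observability matrix, and surjectivity below the left one. *)
Lemma out_eval_eq0 (f : {poly F}) : (size f <= n)%N -> out_eval u A f = 0 -> f = 0.
Proof.
case: obsuA => O' [OO' _] sf; rewrite out_eval_observability // => f0.
have {f0} : \row_(i < n) f`_i = 0.
  by rewrite -[LHS]mulmx1 -OO' mulmxA f0 mul0mx.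
move/rowP => f0; apply/polyP => i; rewrite coef0.
have [ni|lt_in] := leqP n i; first by rewrite nth_default // (leq_trans sf).
by have := f0 (Ordinal lt_in); rewrite !mxE.
Qed.

Lemma out_eval_surj w : exists2 f : {poly F}, (size f <= n)%N & out_eval u A f = w.
Proof.
case: obsuA => O' [_ O'O].
pose f := \poly_(i < n) oapp (fun j => (w *m O') ord0 j) 0 (insub i).
exists f; first exact: size_poly.
rewrite out_eval_observability ?size_poly //.
suff -> : \row_(i < n) f`_i = w *m O' by rewrite -mulmxA O'O mulmx1.
by apply/rowP => i; rewrite mxE coef_poly ltn_ord valK.
Qed.

Lemma size_out_minpoly (divF : division_ring F) :
  size (out_minpoly u A) = n.+1.
Proof.
have [mp Ip] := out_minpolyP divF A u; set p := out_minpoly u A in mp Ip *.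
apply/eqP; rewrite eqn_leq; apply/andP; split; last first.
  rewrite ltnNge; apply/negP => sp; have /eqP := monic_neq0 mp; apply.
  by apply: out_eval_eq0 => //; apply/Ip; exists 1; rewrite mul1r.
have [g sg gE] := out_eval_surj (u *m A ^+ n).
have [r def_r] : exists r, 'X^n - g = r * p.
  by apply/Ip; rewrite out_evalB out_evalXn gE subrr.
have r0 : r != 0.
  by apply: contra_eq_neq (size_XnB sg) => r0; rewrite def_r r0 mul0r size_poly0.
rewrite -(size_XnB sg) def_r size_Mmonic //.
by rewrite -(prednK (n := size r)) ?size_poly_gt0 // addSn leq_addl.
Qed.

End Observable.

Lemma out_similar_minpoly (divF : division_ring F) n n'
    u (A : 'M[F]_n) u' (A' : 'M[F]_n') :
  out_similar u A u' A' -> out_minpoly u A = out_minpoly u' A'.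
Proof.
case=> e; subst n' => -[T [S [TS]]]; rewrite !castmx_id => -> ->.
have [_ ST] := TS; have [mp Ip] := out_minpolyP divF A u.
apply: is_out_minpoly_uniq (out_minpolyP divF _ _).
split=> // q; rewrite -Ip out_eval_similar //; split=> [Tq|->]; last exact: mul0mx.
by rewrite -[LHS]mulmx1 -ST mulmxA Tq mul0mx.
Qed.

Lemma out_minpoly_similar (divF : division_ring F) n n'
    u (A : 'M[F]_n) u' (A' : 'M[F]_n') :
  observable u A -> observable u' A' ->
  out_minpoly u A = out_minpoly u' A' -> out_similar u A u' A'.
Proof.
move=> oA oA' eqp.
have [e] : n.+1 = n'.+1 by rewrite -(size_out_minpoly oA) // eqp size_out_minpoly.
subst n'; have [mp Ip] := out_minpolyP divF A u.
have [_ Ip'] := out_minpolyP divF A' u'.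
have sp := size_out_minpoly oA divF; rewrite -eqp in Ip'.
set p := out_minpoly u A in mp Ip Ip' sp.
have p0 : out_eval u A p = 0 by apply/Ip; exists 1; rewrite mul1r.
have p0' : out_eval u' A' p = 0 by apply/Ip'; exists 1; rewrite mul1r.
case: (oA) (oA') => [O1 OO1] [O1' OO1'].
set O := observability_mx u A in OO1; set O' := observability_mx u' A' in OO1'.
have TS := mx_inverseM (mx_inverseC OO1') OO1.
(* Rows are transported by right multiplication, so S = O^-1 O' is the matrix carrying values at (u,
   A) to values at (u', A'), and T is its inverse. *)
exists erefl, (O1' *m O), (O1 *m O'); rewrite !castmx_id.
set T := O1' *m O in TS *; set S := O1 *m O' in TS *.
have OS : O *m S = O' by rewrite mulmxA OO1.1 mul1mx.
have eval_S (f : {poly F}) : (size f <= n)%N -> out_eval u A f *m S = out_eval u' A' f.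
  by move=> sf; rewrite !out_eval_observability // -mulmxA OS.
have pow_S k : (k <= n)%N -> u *m A ^+ k *m S = u' *m A' ^+ k.
  rewrite leq_eqVlt => /predU1P[->|lt_kn]; last first.
    by rewrite -!out_evalXn eval_S // size_polyXn.
  have := eval_S _ (size_XnB_monic mp sp).
  by rewrite !out_evalB p0 p0' !subr0 !out_evalXn.
(* Row j compares u A^(j+1) S with u' A'^(j+1), again with exponents up to n. *)
have OAS : O *m (A *m S) = O' *m A'.
  have rowO (w : 'rV[F]_n) B (j : 'I_n) :
      row j (observability_mx w B) = w *m B ^+ j.
    by apply/rowP => i; rewrite !mxE.
  clearbody S; apply/row_matrixP => j; rewrite !row_mul !rowO !mulmxA.
  rewrite -!(mulmxA _ (_ ^+ _)) -![_ ^+ _ *m _]/(_ * _).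
  by rewrite -!exprSr pow_S.
split=> //; last by have := pow_S 0 isT; rewrite !expr0 !mulmx1.
by rewrite -!mulmxA OAS mulmxA OO1'.2 mul1mx.
Qed.

End Output.

Local Close Scope ring_scope.

Theorem theorem3p3 (F : unitRingType) (divF : division_ring F) :
  (forall (n n' : nat) (A : 'M[F]_n) (v : 'cV[F]_n)
      (A' : 'M[F]_n') (v' : 'cV[F]_n'),
    0 < n -> 0 < n' -> controllable A v -> controllable A' v' ->
    (in_similar A v A' v' <-> in_minpoly A v = in_minpoly A' v'))
  /\
  (forall (n n' : nat) (u : 'rV[F]_n) (A : 'M[F]_n)
      (u' : 'rV[F]_n') (A' : 'M[F]_n'),
    0 < n -> 0 < n' -> observable u A -> observable u' A' ->
    (out_similar u A u' A' <-> out_minpoly u A = out_minpoly u' A')).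
Proof.
split=> n n' ? ? ? ? _ _ c c'; split.
- exact: in_similar_minpoly.
- exact: in_minpoly_similar.
- exact: out_similar_minpoly.
- exact: out_minpoly_similar.
Qed.
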